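(* For $S=\mathbb{C}^2$, the following equality holds: $$\sum_{n=0}^\infty q^n\int_{[\operatorname{Hilb}^n(S)]^{\mathrm{vir}}}1=e^{\frac{\lambda_1+\lambda_2}{\lambda_1\lambda_2}q}.$$
   Context: The torus $\mathsf{T}=(\mathbb{C}^* )^2$ acts naturally on $S=\mathbb{C}^2$ with tangent weights $t_1,t_2$ at the origin, with equivariant first Chern classes $\lambda_1,\lambda_2$. The equivariant virtual integral is defined by virtual localization: $$\int_{[\operatorname{Hilb}^n(S)]^{\mathrm{vir}}}1=\sum_{|\mu|=n}\frac{1}{e(T^{\mathrm{vir}}_{Z_\mu})}\in\mathbb{C}(\lambda_1,\lambda_2),$$ summing over partitions $\mu$ of $n$. A partition $\mu$ is identified with its set of boxes $\{(i,j)\in\mathbb{Z}_{\ge0}^2:j<\mu_{i+1}\}$, $Q_\mu=\sum_{(i,j)\in\mu}t_1^{-j}t_2^{-i}$, and $T^{\mathrm{vir}}_{Z_\mu}=Q_\mu-(1-t_1)(1-t_2)\overline{Q_\mu}Q_\mu$, where $\overline{(\cdot)}$ inverts all weights. For a virtual character $\sum n_\chi\chi$, $e=\prod_\chi c_1(\chi)^{n_\chi}$, where $c_1(t_1^at_2^b)=a\lambda_1+b\lambda_2$. *)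

(* Defs.v *)
From mathcomp Require Import all_boot all_order all_algebra.
From mathcomp Require Import reals complex freeg mpoly.

Set Implicit Arguments.
Unset Strict Implicit.
Unset Printing Implicit Defensive.

Import GRing.Theory.
Local Open Scope ring_scope.

(* The character t_1^a t_2^b of the torus is the pair (a, b), so that the group
   law of characters is the addition of int * int.  A virtual character is an
   element of the free abelian group on the characters, with product [vmul]
   extending the group law bilinearly. *)
Definition vchar := {freeg (int * int) / int}.

Definition vmon (a b : int) : vchar := << (1 : int) *g (a, b) >>.

Definition t1 : vchar := vmon 1 0.
Definition t2 : vchar := vmon 0 1.

Definition vmul (V W : vchar) : vchar :=
  \sum_(x <- dom V) \sum_(y <- dom W) << coeff x V * coeff y W *g x + y >>.

Definition vdual (V : vchar) : vchar :=
  \sum_(x <- dom V) << coeff x V *g - x >>.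

Definition is_partition (n : nat) (mu : seq nat) : bool :=
  [&& sorted geq mu, 0%N \notin mu & sumn mu == n].

Definition Qchar (mu : seq nat) : vchar :=
  \sum_(i < size mu) \sum_(j < nth 0%N mu i) vmon (- j%:Z) (- i%:Z).

Definition Tvir (mu : seq nat) : vchar :=
  let Q := Qchar mu in
  Q - vmul (vmul (vmul (vmon 0 0 - t1) (vmon 0 0 - t2)) (vdual Q)) Q.

(* C(lambda_1, lambda_2), where C = R[i] and R is the complete ordered field. *)
Notation ratfun R := {fraction {mpoly R[i][2]}}.

Definition lam1 (R : realType) : ratfun R := tofrac 'X_(0 : 'I_2).
Definition lam2 (R : realType) : ratfun R := tofrac 'X_(1 : 'I_2).

Definition c1 (R : realType) (chi : int * int) : ratfun R :=
  lam1 R *~ chi.1 + lam2 R *~ chi.2.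

(* [dom V] is the (duplicate-free) list of characters of nonzero multiplicity. *)
Definition euler (R : realType) (V : vchar) : ratfun R :=
  \prod_(chi <- dom V) c1 R chi ^ coeff chi V.

(* A partition of n has at most n parts, each at most n, so the finite type
   [n.-bseq 'I_n.+1] contains each partition of n exactly once. *)
Definition hilb_vir_integral (R : realType) (n : nat) : ratfun R :=
  \sum_(mu : n.-bseq 'I_n.+1 | is_partition n (map val mu))
     (euler R (Tvir (map val mu)))^-1.

(* Formal power series in q are given by their sequences of coefficients.
   For f with f`_0 = 0, f ^+ k does not contribute to the coefficient of q^n
   when n < k, so the sum below is the whole coefficient of sum_k f^k / k!. *)
Definition fps_exp (K : fieldType) (f : {poly K}) : nat -> K :=
  fun n => (\sum_(k < n.+1) (k`!%:R)^-1 *: f ^+ k)`_n.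

(* Main.v *)
From HB Require Import structures.
Require Import Defs.
From mathcomp Require Import all_boot all_order all_algebra.
From mathcomp Require Import reals complex freeg mpoly.
From mathcomp Require Import ring zify.
Set Implicit Arguments.
Unset Strict Implicit.
Unset Printing Implicit Defensive.
Import GRing.Theory.
Local Open Scope ring_scope.

(** Describe a partition by its row lengths [r 0 >= r 1 >= ...], and bound its
    outline by the points [x_k = (k, r k)] and [y_k = (k.+1, r k)], with row
    index first.  Telescoping [(1 - t1^-1) (1 - t2^-1) Q] along rows and columns
    leaves only these points:
      [(1 - t1^-1) (1 - t2^-1) Q = 1 - \sum_k x_k + \sum_k y_k]
    (a point [(a, j)] standing for [t1^-j t2^-a]), and dually for the conjugate
    of [Q].  So the virtual tangent space is [\sum_b \sum_k (b / x_k - b / y_k)]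
    over the boxes [b], and its inverse Euler class is the explicit product
      [H = \prod_b (\prod_k (b - y_k) / \prod_k (b - x_k))]
    of differences of weights; no trivial character occurs in it.

    Up to the factor [\prod_b (l1 + l2 - b)], [H] is the Jack deformation of the
    Plancherel measure, and the sum over partitions of size [n] is computed by
    growing partitions one box at a time.  If [nu] is [mu] with a box [w] added
    in row [i], the telescoping identity computes [H nu / H mu], and
      [H nu * down nu i = H mu * up mu i]                ([hilb_weight_balance])
    where
      [up mu i = (l1 + l2 - x_i) \prod_k (x_i - y_k) / \prod_(k != i) (x_i - x_k)],
      [down nu i = \prod_k (x_k - y_i) / \prod_(k != i) (y_k - y_i)].
    Both are terms of a Lagrange interpolation, at the nodes [x_k] and [y_k]
    respectively.  Summed over all rows they give
      [\sum_i up mu i = l1 + l2]  and  [\sum_i down nu i = l1 l2 |nu|],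
    because the first two power sums of the [x_k] and of the [y_k] have known
    differences, once more by the telescoping identity.  Rows to which no box can be added, or from which none
    can be removed, contribute zero to these sums, since there [x_i = y_(i-1)],
    resp. [y_i = x_(i+1)].  Summing the balance over all pairs ([mu], [nu]) gives
      [(n + 1) l1 l2 I_(n+1) = (l1 + l2) I_n],
    where [I_n] is the sum of [H] over the partitions of [n]; hence
    [I_n = ((l1 + l2) / (l1 l2))^n / n!], the coefficient of the exponential. *)

(** * Lagrange interpolation sums *)

(** The left side is the top coefficient of the Lagrange interpolant of [p],
    which is [p] itself. *)
Lemma coef_divided_difference (F : fieldType) n (a : 'I_n.+1 -> F) (p : {poly F}) :
  injective a -> (size p <= n.+1)%N ->
  \sum_i p.[a i] / \prod_(k | k != i) (a i - a k) = p`_n.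
Proof.
move=> a_inj sz_p.
pose ell i : {poly F} := \prod_(k | k != i) ('X - (a k)%:P).
have szE i : size (ell i) = n.+1.
  rewrite /ell -big_filter size_prod_XsubC.
  by have [e _ _ [_ ->]] := big_enumP; rewrite cardC1 card_ord.
pose c i := p.[a i] / \prod_(k | k != i) (a i - a k).
have eqp : p - \sum_i c i *: ell i = 0.
  apply: (@roots_geq_poly_eq0 _ _ [seq a i | i <- enum 'I_n.+1]).
  - apply/allP => _ /mapP[i _ ->]; apply/rootP.
    rewrite hornerD hornerN horner_sum (bigD1 i) //= big1 => [|k k_i].
      rewrite addr0 hornerZ /ell horner_prod.
      under eq_bigr do rewrite hornerXsubC.
      rewrite divfK ?subrr //; apply/prodf_neq0 => k k_i.
      by rewrite subr_eq0 (inj_eq a_inj) eq_sym.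
    by rewrite hornerZ /ell horner_prod (bigD1 i) 1?eq_sym //= hornerXsubC subrr mul0r mulr0.
  - by rewrite map_inj_uniq ?enum_uniq.
  - rewrite size_map size_enum_ord (leq_trans (size_polyD _ _)) // geq_max sz_p size_polyN.
    apply: (leq_trans (size_sum _ _ _)); apply/bigmax_leqP => i _.
    by rewrite (leq_trans (size_scale_leq _ _)) // szE.
rewrite -[p in RHS](subrK (\sum_i c i *: ell i)) eqp add0r coef_sum.
apply: eq_bigr => i _; rewrite coefZ.
suff -> : (ell i)`_n = 1 by rewrite mulr1.
have := lead_coef_prod_XsubC (index_enum 'I_n.+1) (fun k => k != i) a.
by rewrite lead_coefE -/(ell i) szE.
Qed.

Lemma coef_sub1_prod_XsubC (F : fieldType) n (a : 'I_n.+1 -> F) :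
  (\prod_i ('X - (a i)%:P))`_n = - \sum_i a i.
Proof.
rewrite -(big_map a xpredT (fun z => 'X - z%:P)).
have sz : size (map a (index_enum 'I_n.+1)) = n.+1.
  by rewrite size_map /index_enum locked_withE -enumT size_enum_ord.
have := @coefPn_prod_XsubC _ (map a (index_enum 'I_n.+1)).
by rewrite sz => ->; rewrite // big_map.
Qed.

Lemma coef_sub2_prod_XsubC (F : fieldType) n (a : 'I_n.+2 -> F) :
  (\prod_i ('X - (a i)%:P))`_n *+ 2 = (\sum_i a i) ^+ 2 - \sum_i a i ^+ 2.
Proof.
elim: n a => [|n IHn] a.
  rewrite !big_ord_recl !big_ord0 mulr1 coef0M !coefB !coefX !coefC /=; ring.
rewrite big_ord_recl mulrBl coefB coefXM coefCM /= coef_sub1_prod_XsubC.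
rewrite mulrnBl IHn !(big_ord_recl n.+2) /=; ring.
Qed.

Lemma size_prod_XsubC_ord (F : fieldType) n (a : 'I_n -> F) :
  size (\prod_i ('X - (a i)%:P)) = n.+1.
Proof. by rewrite size_prod_XsubC /index_enum locked_withE -enumT size_enum_ord. Qed.

Lemma coef_top_prod_XsubC (F : fieldType) n (a : 'I_n -> F) :
  (\prod_i ('X - (a i)%:P))`_n = 1.
Proof.
have := lead_coef_prod_XsubC (index_enum 'I_n) xpredT a.
by rewrite lead_coefE size_prod_XsubC_ord.
Qed.

(** The sum is the divided difference of [(m - X) \prod_k (X - y_k)]; adding
    [\prod_k (X - x_k)], which vanishes at the nodes, makes the degree small
    enough to read it off as a coefficient. *)
Lemma transition_mean (F : fieldType) n (m : F) (x : 'I_n.+2 -> F) (y : 'I_n.+1 -> F) :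
  injective x ->
  \sum_i (m - x i) * (\prod_k (x i - y k) / \prod_(k | k != i) (x i - x k))
    = m - \sum_i x i + \sum_i y i.
Proof.
move=> x_inj.
pose Y := \prod_i ('X - (y i)%:P); pose X := \prod_i ('X - (x i)%:P).
pose p := (m%:P - 'X) * Y + X.
have p_x i : p.[x i] = (m - x i) * \prod_k (x i - y k).
  rewrite hornerD hornerM /X /Y !horner_prod (bigD1 i) //= !hornerE subrr mul0r addr0.
  by congr (_ * _); apply: eq_bigr => k _; rewrite !hornerE.
have p_top : p`_n.+1 = m - \sum_i x i + \sum_i y i.
  by rewrite coefD mulrBl coefB coefCM coefXM /= coef_top_prod_XsubC !coef_sub1_prod_XsubC; ring.
have sz_p : (size p <= n.+2)%N.
  apply/leq_sizeP => j; rewrite leq_eqVlt => /predU1P[<-|lt_j].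
    rewrite coefD mulrBl coefB coefCM coefXM /= !coef_top_prod_XsubC.
    by rewrite nth_default ?size_prod_XsubC_ord //; ring.
  have [szX szY] := (size_prod_XsubC_ord x, size_prod_XsubC_ord y).
  rewrite coefD mulrBl coefB coefCM coefXM; case: j lt_j => //= j lt_j.
  by rewrite !nth_default ?szX ?szY ?mulr0 ?subr0 ?addr0 // ltnW.
rewrite -p_top -(coef_divided_difference x_inj sz_p).
by apply: eq_bigr => i _; rewrite p_x mulrA.
Qed.

(** Same method at the nodes [y_k], for [\prod_k (X - x_k)].  Here the degree is
    lowered by [X * \prod_k (X - y_k)]: equality of the first power sums removes
    one more coefficient, and the next one is a difference of second elementary
    symmetric functions, hence of second power sums. *)
Lemma cotransition_mass (F : fieldType) n (x : 'I_n.+2 -> F) (y : 'I_n.+1 -> F) :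
  injective y -> \sum_i x i = \sum_i y i ->
  (\sum_i \prod_k (x k - y i) / \prod_(k | k != i) (y k - y i)) *+ 2
    = \sum_i y i ^+ 2 - \sum_i x i ^+ 2.
Proof.
move=> y_inj eq_xy.
pose Y := \prod_i ('X - (y i)%:P); pose X := \prod_i ('X - (x i)%:P).
pose p := X - 'X * Y.
have p_y i : p.[y i] = \prod_k (y i - x k).
  have Y_y : Y.[y i] = 0 by rewrite horner_prod (bigD1 i) //= hornerXsubC subrr mul0r.
  rewrite hornerD hornerN hornerM Y_y mulr0 subr0 horner_prod.
  by apply: eq_bigr => k _; rewrite hornerXsubC.
have sz_p : (size p <= n.+1)%N.
  apply/leq_sizeP => j; rewrite coefB coefXM leq_eqVlt => /predU1P[<-|].
    by rewrite /= !coef_sub1_prod_XsubC eq_xy subrr.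
  have [szX szY] := (size_prod_XsubC_ord x, size_prod_XsubC_ord y).
  case: j => // j; rewrite ltnS leq_eqVlt => /predU1P[<-|lt_j] /=.
    by rewrite !coef_top_prod_XsubC subrr.
  by rewrite !nth_default ?szX ?szY ?subr0.
have p_top : p`_n *+ 2 = \sum_i y i ^+ 2 - \sum_i x i ^+ 2.
  rewrite coefB coefXM mulrnBl coef_sub2_prod_XsubC eq_xy /Y.
  clear -eq_xy; case: n x y eq_xy => [|n] x y eq_xy.
    by rewrite !big_ord_recr !big_ord0 /=; ring.
  by rewrite /= coef_sub2_prod_XsubC; ring.
rewrite -p_top -(coef_divided_difference y_inj sz_p); congr (_ *+ 2).
apply: eq_bigr => i _; rewrite p_y.
(* The numerator and the denominator have numbers of factors of equal parity. *)
have flip (I : finType) (P : pred I) (u : I -> F) c :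
    \prod_(k | P k) (u k - c) = (-1) ^+ #|P| * \prod_(k | P k) (c - u k).
  by rewrite -prodrN; apply: eq_bigr => k _; rewrite opprB.
rewrite !flip cardC1 !card_ord /= !exprS.
by rewrite !mulN1r opprK -mulf_div divff ?signr_eq0 // mul1r.
Qed.

(** * Telescoping over the boxes of a diagram *)

(** In each row all terms but the first and the last cancel, then so do the
    terms of the first column.  Having both sides without inverses lets one
    identity serve for sums of weights and of their squares, for sums of
    characters, and for products of differences of weights. *)
Lemma big_boxes_corners (T : Type) (idx : T) (op : Monoid.com_law idx)
    (g : nat -> nat -> T) (r : nat -> nat) (N : nat) : r N = 0%N ->
  op (op (g 0%N 0%N) (\big[op/idx]_(k < N) g k.+1 (r k)))
     (op (\big[op/idx]_(a < N) \big[op/idx]_(j < r a) g a j.+1)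
         (\big[op/idx]_(a < N) \big[op/idx]_(j < r a) g a.+1 j))
  = op (\big[op/idx]_(k < N.+1) g k (r k))
       (op (\big[op/idx]_(a < N) \big[op/idx]_(j < r a) g a j)
           (\big[op/idx]_(a < N) \big[op/idx]_(j < r a) g a.+1 j.+1)).
Proof.
move=> rN; rewrite big_ord_recr /= rN {rN}.
have row a : op (g a 0%N) (\big[op/idx]_(j < r a) g a j.+1)
    = op (\big[op/idx]_(j < r a) g a j) (g a (r a)).
  by rewrite -(big_ord_recl (r a) (fun j => g a j)) big_ord_recr.
have row1 a : op (g a.+1 (r a)) (\big[op/idx]_(j < r a) g a.+1 j)
    = op (\big[op/idx]_(j < r a) g a.+1 j.+1) (g a.+1 0%N).
  by rewrite Monoid.mulmC -(big_ord_recr (r a) (fun j => g a.+1 j)) big_ord_recl Monoid.mulmC.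
elim: N => [|N IHN]; first by rewrite !big_ord0 !Monoid.simpm.
rewrite !(big_ord_recr N) /=.
(* Separate the contribution of the last row from the rest. *)
transitivity (op (op (op (g 0%N 0%N) (\big[op/idx]_(k < N) g k.+1 (r k)))
     (op (\big[op/idx]_(a < N) \big[op/idx]_(j < r a) g a j.+1)
         (\big[op/idx]_(a < N) \big[op/idx]_(j < r a) g a.+1 j)))
   (op (\big[op/idx]_(j < r N) g N j.+1)
       (op (g N.+1 (r N)) (\big[op/idx]_(j < r N) g N.+1 j)))).
  by rewrite [LHS](AC ((1*2)*(2*2)) ((1*2*(4*6))*(5*(3*7)))).
rewrite IHN row1.
set X := \big[_/_]_(_ < _) _; set S := \big[_/_]_(_ < _) \big[_/_]_(_ < _) _.
set S' := \big[_/_]_(_ < _) \big[_/_]_(_ < _) _.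
rewrite [LHS](AC ((2*2)*(1*2)) ((1*3*4*6*7)*(2*5))) row.
by rewrite [LHS](AC (5*2) ((1*7*5)*((2*6)*(3*4)))).
Qed.

Lemma sum_corners (V : zmodType) (g : nat -> nat -> V) (r : nat -> nat) (N : nat) :
  r N = 0%N ->
  \sum_(k < N) g k.+1 (r k) - \sum_(k < N.+1) g k (r k)
  = \sum_(a < N) \sum_(j < r a) (g a j + g a.+1 j.+1 - (g a j.+1 + g a.+1 j)) - g 0%N 0%N.
Proof.
move=> rN; pose bx (f : nat -> nat -> V) := \sum_(a < N) \sum_(j < r a) f a j.
have bxD f f' : bx (fun a j => f a j + f' a j) = bx f + bx f'.
  by rewrite -big_split; apply: eq_bigr => a _; rewrite -big_split.
have -> : \sum_(a < N) \sum_(j < r a) (g a j + g a.+1 j.+1 - (g a j.+1 + g a.+1 j))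
    = bx (fun a j => g a j + g a.+1 j.+1) - bx (fun a j => g a j.+1 + g a.+1 j).
  by rewrite -sumrB; apply: eq_bigr => a _; rewrite -sumrB.
have := big_boxes_corners (@GRing.add V : Monoid.com_law 0) g rN.
rewrite !bxD -/(bx (fun a j => g a j)) -/(bx (fun a j => g a.+1 j)) /=.
rewrite -/(bx (fun a j => g a j.+1)) -/(bx (fun a j => g a.+1 j.+1)).
move=> /(canLR (addKr _)) <-.
by rewrite (addrA (- _)) addrK (addrC (g _ _)) addrA addrK addrC.
Qed.

(** * Weights of diagrams and of added boxes *)

Section Weights.
Variables (F : fieldType) (l1 l2 : F).

Definition wt (p : nat * nat) : F := - (l1 *+ p.2 + l2 *+ p.1).
(** The convention at [p = q] keeps all values nonzero, so that the telescoping
    product may pass through coinciding points; the final formulas only involve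
    true differences. *)
Definition wdiff (p q : nat * nat) : F := if p == q then 1 else wt p - wt q.

(** The part of [1 / e(Tvir)] carried by the box [p], for a diagram with at most
    [N] rows.  Empty rows may be included since there [x_(k+1) = y_k]. *)
Definition box_weight N (r : nat -> nat) (p : nat * nat) : F :=
  \prod_(k < N) wdiff p (k.+1, r k) / \prod_(k < N.+1) wdiff p (k : nat, r k).

Definition hilb_weight N (r : nat -> nat) : F :=
  \prod_(a < N) \prod_(j < r a) box_weight N r (a : nat, j : nat).

Lemma wt00 : wt (0, 0)%N = 0.
Proof. by rewrite /wt /= !mulr0n addr0 oppr0. Qed.

(** This says that the weights [l1] and [l2] are linearly independent over the
    integers; it also forces characteristic 0. *)
Hypothesis wt_inj : injective wt.

Lemma wdiff_neq0 p q : wdiff p q != 0.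
Proof.
rewrite /wdiff; case: ifPn => [_|pq]; first by rewrite oner_eq0.
by rewrite subr_eq0 (inj_eq wt_inj).
Qed.

Lemma wdiffpp p : wdiff p p = 1. Proof. by rewrite /wdiff eqxx. Qed.

Lemma wdiffE p q : p != q -> wdiff p q = wt p - wt q.
Proof. by rewrite /wdiff => /negbTE->. Qed.

Lemma wdiff_shift a b c d e f :
  wdiff (e + a, f + b)%N (e + c, f + d)%N = wdiff (a, b) (c, d).
Proof.
rewrite /wdiff !xpair_eqE !eqn_add2l; case: ifP => // _.
by rewrite /wt /= !mulrnDr; ring.
Qed.

Lemma wdiff_right a j : wdiff (a, j) (a, j.+1) = l1.
Proof. by rewrite wdiffE ?xpair_eqE; [rewrite /wt /= mulrS; ring | lia]. Qed.

Lemma wdiff_down a j : wdiff (a, j) (a.+1, j) = l2.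
Proof. by rewrite wdiffE ?xpair_eqE; [rewrite /wt /= mulrS; ring | lia]. Qed.

Lemma wdiff_diag a j : wdiff (a, j) (a.+1, j.+1) = l1 + l2.
Proof. by rewrite wdiffE ?xpair_eqE; [rewrite /wt /= !mulrS; ring | lia]. Qed.

Lemma l1_neq0 : l1 != 0. Proof. by rewrite -(wdiff_right 0 0) wdiff_neq0. Qed.

Lemma l2_neq0 : l2 != 0. Proof. by rewrite -(wdiff_down 0 0) wdiff_neq0. Qed.

Lemma big_boxes_incr (T : Type) (idx : T) (op : Monoid.com_law idx) N
    (g : nat -> nat -> T) (r r' : nat -> nat) (i : 'I_N) :
  (forall k, r' k = (k == i) + r k)%N ->
  \big[op/idx]_(a < N) \big[op/idx]_(j < r' a) g a j =
  op (g i (r i)) (\big[op/idx]_(a < N) \big[op/idx]_(j < r a) g a j).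
Proof.
move=> r'E; rewrite (bigD1 i) //= r'E eqxx big_ord_recr /=.
rewrite [in RHS](bigD1 i) //= [RHS]Monoid.mulmA.
congr (op _ _); first exact: Monoid.mulmC.
apply: eq_bigr => a /negbTE a_i.
by rewrite r'E (inj_eq val_inj) a_i.
Qed.

Lemma prod_change N (i : 'I_N) (u v : nat -> F) :
  (forall k : nat, k != i -> u k = v k) -> v i != 0 ->
  \prod_(k < N) u k = \prod_(k < N) v k * (u i / v i).
Proof.
move=> uv vi0; rewrite (bigD1 i) //= [in RHS](bigD1 i) //=.
rewrite (eq_bigr (fun k : 'I_N => v k)) => [|k k_i]; last by rewrite uv.
by field.
Qed.

(** Adding the box [w] has two effects: [w] contributes its own factor, and the
    two boundary points of row [i] move by one step.  The second effect changes
    the factor of each box [b] by a second difference of [wdiff b w], so its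
    total is given by the telescoping identity. *)
Lemma hilb_weight_incr N (r r' : nat -> nat) (i : 'I_N) :
  r N = 0%N -> (forall k, r' k = (k == i) + r k)%N ->
  let w : nat * nat := (i : nat, r i) in
  let w11 : nat * nat := (i.+1, (r i).+1) in
  hilb_weight N r' = hilb_weight N r * box_weight N r w * ((l1 + l2) / (l1 * l2))
    * ((l1 + l2 - wt w) * \prod_(k < N) wdiff (k.+1, r k) w11
        / \prod_(k < N.+1) wdiff (k : nat, r k) w11).
Proof.
move=> rN r'E w w11.
have r'i : r' i = (r i).+1 by rewrite r'E eqxx.
have r'k (k : nat) : k != i -> r' k = r k by rewrite r'E => /negbTE->.
(* Effect on the factor of [p] of moving the two boundary points of row [i]. *)
pose ratio p := (wdiff p w11 / wdiff p (i.+1, r i))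
  / (wdiff p (i : nat, (r i).+1) / wdiff p w).
have twE p : box_weight N r' p = box_weight N r p * ratio p.
  rewrite /box_weight.
  rewrite (prod_change (i := i) (u := fun k => wdiff p (k.+1, r' k))
     (v := fun k => wdiff p (k.+1, r k))) ?wdiff_neq0 //; last by move=> k /r'k ->.
  rewrite (prod_change (i := widen_ord (leqnSn N) i)
     (u := fun k => wdiff p (k, r' k))
     (v := fun k => wdiff p (k, r k))) ?wdiff_neq0 //; last by move=> k /r'k ->.
  by rewrite /= r'i -/w11 -/w /ratio -mulf_div.
have ww : ratio w = (l1 + l2) / (l1 * l2).
  rewrite /ratio wdiffpp wdiff_diag wdiff_down wdiff_right.
  by rewrite divr1 -mulrA -invfM (mulrC l2).
have big_ratio : \prod_(a < N) \prod_(j < r a) ratio (a : nat, j : nat)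
   = (l1 + l2 - wt w) * \prod_(k < N) wdiff (k.+1, r k) w11
        / \prod_(k < N.+1) wdiff (k : nat, r k) w11.
  (* By translation invariance [ratio b] is a second difference of [wdiff b w11],
     with [w11] diagonally next to [w]. *)
  pose bx (u v : nat -> nat -> nat) :=
    \prod_(a < N) \prod_(j < r a) wdiff (u a j, v a j) w11.
  pose S := bx (fun a j => a) (fun a j => j).
  pose S01 := bx (fun a j => a) (fun a j => j.+1).
  pose S10 := bx (fun a j => a.+1) (fun a j => j).
  pose S11 := bx (fun a j => a.+1) (fun a j => j.+1).
  pose X := \prod_(k < N.+1) wdiff (k : nat, r k) w11.
  pose Y := \prod_(k < N) wdiff (k.+1, r k) w11.
  pose g00 := wdiff (0%N, 0%N) w11.
  have eqS : g00 * Y * (S01 * S10) = X * (S * S11).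
    exact: (big_boxes_corners (@GRing.mul F : Monoid.com_law 1)
              (fun a j => wdiff (a, j) w11) rN).
  have -> : l1 + l2 - wt w = g00.
    by rewrite /g00 wdiffE // /wt /= !mulrS !mulr0n; ring.
  have -> : \prod_(a < N) \prod_(j < r a) ratio (a : nat, j : nat)
       = S / S01 / (S10 / S11).
    rewrite /S /S01 /S10 /S11 /bx -!prodf_div; apply: eq_bigr => a _.
    rewrite -!prodf_div; apply: eq_bigr => j _; rewrite /ratio.
    have sh1 b c d e : wdiff (b, c.+1) (d, e.+1) = wdiff (b, c) (d, e).
      exact: (wdiff_shift b c d e 0 1).
    have sh2 b c d e : wdiff (b.+1, c) (d.+1, e) = wdiff (b, c) (d, e).
      exact: (wdiff_shift b c d e 1 0).
    by rewrite /w11 !sh1 !sh2.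
  have nzX : X != 0 by apply/prodf_neq0 => k _; apply: wdiff_neq0.
  have nzS u v : bx u v != 0.
    by apply/prodf_neq0 => a _; apply/prodf_neq0 => j _; apply: wdiff_neq0.
  rewrite -/X -/Y; apply: (canRL (mulfK nzX)).
  rewrite mulrC; apply: (mulIf (mulf_neq0 (nzS _ _ : S01 != 0) (nzS _ _ : S10 != 0))).
  rewrite eqS; field.
  by rewrite !nzS.
rewrite [LHS](big_boxes_incr (@GRing.mul F : Monoid.com_law 1)
  (fun a j => box_weight N r' (a, j)) r'E) /= -/w twE ww.
have -> : \prod_(a < N) \prod_(j < r a) box_weight N r' (a : nat, j : nat)
    = hilb_weight N r * \prod_(a < N) \prod_(j < r a) ratio (a : nat, j : nat).
  rewrite -big_split; apply: eq_bigr => a _.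
  by rewrite -big_split; apply: eq_bigr => j _; rewrite twE.
rewrite big_ratio.
by rewrite [LHS]mulrA (mulrC _ (hilb_weight N r)) !mulrA.
Qed.

(** The fraction is the transition probability, in the Jack-Plancherel growth
    process, of adding a box at the end of row [i]. *)
Definition up_weight N (r : nat -> nat) (i : 'I_N.+1) : F :=
  let x (k : nat) := wt (k, r k) in
  (l1 + l2 - x i) *
    (\prod_(k < N) (x i - wt (k.+1, r k)) / \prod_(k < N.+1 | k != i) (x i - x k)).

(** Up to normalization, the probability of removing the last box of row [i] in
    the reversed growth process. *)
Definition down_weight N (r : nat -> nat) (i : 'I_N) : F :=
  let y (k : nat) := wt (k.+1, r k) in
  \prod_(k < N.+1) (wt (k : nat, r k) - y i) / \prod_(k < N | k != i) (y k - y i).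

Lemma natr_neq0 n : n.+1%:R != 0 :> F.
Proof.
apply/eqP => n0; suff /wt_inj[] : wt (n.+1, 0)%N = wt (0, 0)%N by [].
by rewrite /wt /= -[_ *+ n.+1]mulr_natr n0 mulr0.
Qed.

(** The points [x_k] and [y_k] have the same sum of weights, because weights are
    affine on the grid and their mixed second differences vanish. *)
Lemma sum_up_weight n (r : nat -> nat) : r n.+1 = 0%N ->
  \sum_(i < n.+2) up_weight r i = l1 + l2.
Proof.
move=> rN.
rewrite (transition_mean (l1 + l2) (x := fun k : 'I_n.+2 => wt (k : nat, r k))
  (fun k : 'I_n.+1 => wt (k.+1, r k))) => [|k k' /wt_inj[]]; last first.
  by move=> /val_inj.
rewrite -addrA [X in _ + X]addrC (sum_corners (fun a j => wt (a, j)) rN) big1 => [|a _].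
  by rewrite sub0r wt00 oppr0 addr0.
by apply: big1 => j _; rewrite /wt /= !mulrS; ring.
Qed.

(** The mixed second difference of the square of the weight is the constant
    [2 l1 l2], so the second power sums of the points count the boxes. *)
Lemma sum_down_weight n (r : nat -> nat) : r n.+1 = 0%N ->
  \sum_(i < n.+1) down_weight r i = l1 * l2 *+ (\sum_(a < n.+1) r a).
Proof.
move=> rN.
have y_inj : injective (fun k : 'I_n.+1 => wt (k.+1, r k)).
  by move=> k k' /wt_inj[/val_inj].
have eq_xy : \sum_(k < n.+2) wt (k : nat, r k) = \sum_(k < n.+1) wt (k.+1, r k).
  apply/eqP; rewrite eq_sym -subr_eq0 (sum_corners (fun a j => wt (a, j)) rN) big1 => [|a _].
    by rewrite sub0r wt00 oppr0.
  by apply: big1 => j _; rewrite /wt /= !mulrS; ring.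
have := cotransition_mass y_inj eq_xy.
rewrite (sum_corners (fun a j => wt (a, j) ^+ 2) rN) wt00 expr0n subr0.
have -> : \sum_(a < n.+1) \sum_(j < r a) (wt (a : nat, j : nat) ^+ 2
      + wt (a.+1, j.+1) ^+ 2 - (wt (a : nat, j.+1) ^+ 2 + wt (a.+1, j : nat) ^+ 2))
    = \sum_(a < n.+1) l1 * l2 *+ 2 *+ r a.
  apply: eq_bigr => a _; rewrite -[r a in RHS]card_ord -sumr_const.
  by apply: eq_bigr => j _; rewrite /wt /= !mulrS; ring.
rewrite sumrMnr mulrnAC => eq2.
by apply: (mulIf (natr_neq0 1)); rewrite !mulr_natr.
Qed.

(** No box can be added to row [i] when the row above has the same length. *)
Lemma up_weight_eq0 N (r : nat -> nat) (i : 'I_N.+1) k :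
  i = k.+1 :> nat -> r k = r i -> up_weight r i = 0.
Proof.
move=> ik rk; have lt_kN : (k < N)%N by rewrite -ltnS -ik.
by rewrite /up_weight (bigD1 (Ordinal lt_kN)) //= rk -ik subrr !mul0r mulr0.
Qed.

(** No box can be removed from row [i] when the row below has the same length. *)
Lemma down_weight_eq0 N (r : nat -> nat) (i : 'I_N) :
  r i.+1 = r i -> down_weight r i = 0.
Proof.
move=> ri; have lt_iN : (i.+1 < N.+1)%N by rewrite ltnS.
by rewrite /down_weight (bigD1 (Ordinal lt_iN)) //= ri subrr !mul0r.
Qed.

(** Detailed balance.  Monotonicity of both diagrams ensures that the boundary
    points appearing in [up_weight] and [down_weight] differ from the new box and
    its diagonal neighbour, so the regularized differences of
    [hilb_weight_incr] are the true ones. *)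
Lemma hilb_weight_balance N (r r' : nat -> nat) (i : 'I_N) :
  r N = 0%N -> (forall k, r' k = (k == i) + r k)%N ->
  (forall k, r k.+1 <= r k)%N -> (forall k, r' k.+1 <= r' k)%N ->
  hilb_weight N r' * down_weight r' i
  = hilb_weight N r * up_weight r (widen_ord (leqnSn N) i).
Proof.
move=> rN r'E r_dec r'_dec; rewrite (hilb_weight_incr rN r'E).
set w : nat * nat := (i : nat, r i).
set w11 : nat * nat := (i.+1, (r i).+1).
have r'i : r' i = (r i).+1 by rewrite r'E eqxx.
have r'k (k : nat) : k != i -> r' k = r k by rewrite r'E => /negbTE->.
have nz11 : l1 + l2 != 0 by rewrite -(wdiff_diag 0 0) wdiff_neq0.
have [nz1 nz2] := (l1_neq0, l2_neq0).
pose X := \prod_(k < N.+1) wdiff (k : nat, r k) w11.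
pose Y := \prod_(k < N) wdiff (k.+1, r k) w11.
have nzX : X != 0 by apply/prodf_neq0 => k _; apply: wdiff_neq0.
have nzY : Y != 0 by apply/prodf_neq0 => k _; apply: wdiff_neq0.
have -> : up_weight r (widen_ord (leqnSn N) i)
    = (l1 + l2 - wt w) * box_weight N r w.
  rewrite /up_weight /box_weight /= -/w; congr (_ * (_ / _)).
    apply: eq_bigr => k _; rewrite wdiffE // xpair_eqE negb_and.
    case: eqVneq => //= ik; apply/negP => /eqP rik.
    by have := r'_dec k; rewrite -ik r'i r'k ?rik ?ltnn // ik neq_ltn ltnSn.
  rewrite [RHS](bigD1 (widen_ord (leqnSn N) i)) //= wdiffpp mul1r.
  apply: eq_bigr => k k_i; rewrite wdiffE // xpair_eqE negb_and.
  by rewrite eq_sym k_i.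
have -> : down_weight r' i = l1 * l2 / (l1 + l2) *
    (\prod_(k < N.+1) wdiff (k : nat, r k) w11 / \prod_(k < N) wdiff (k.+1, r k) w11).
  rewrite /down_weight /= r'i -/w11.
  have -> : \prod_(k < N.+1) (wt (k : nat, r' k) - wt w11)
      = \prod_(k < N.+1) wdiff (k : nat, r' k) w11.
    apply: eq_bigr => k _; rewrite wdiffE // xpair_eqE negb_and.
    case: eqVneq => //= ik; rewrite ik r'k; last by rewrite gtn_eqF.
    by rewrite neq_ltn ltnS r_dec.
  have -> : \prod_(k < N | k != i) (wt (k.+1, r' k) - wt w11)
      = \prod_(k < N) wdiff (k.+1, r' k) w11.
    rewrite [RHS](bigD1 i) //= r'i wdiffpp mul1r.
    apply: eq_bigr => k k_i; rewrite wdiffE // /w11 xpair_eqE eqSS.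
    by rewrite (inj_eq val_inj) (negbTE k_i).
  rewrite (prod_change (i := i) (u := fun k => wdiff (k.+1, r' k) w11)
     (v := fun k => wdiff (k.+1, r k) w11)) ?wdiff_neq0 //; last by move=> k /r'k ->.
  rewrite (prod_change (i := widen_ord (leqnSn N) i)
     (u := fun k => wdiff (k, r' k) w11)
     (v := fun k => wdiff (k, r k) w11)) ?wdiff_neq0 //; last by move=> k /r'k ->.
  rewrite -/X -/Y /= r'i -/w -/w11 wdiffpp wdiff_diag wdiff_right wdiff_down.
  move: (X) (Y) nzX nzY => A B nzA nzB; field.
  by rewrite nz11 nz1 nzB.
rewrite -/X -/Y.
move: (X) (Y) nzX nzY (box_weight N r w) (hilb_weight N r) => A B nzA nzB T W; field.
by rewrite nz11 nz1 nz2 nzA nzB.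
Qed.

End Weights.

(** * The list of partitions of an integer *)

Definition partitions n : seq (seq nat) :=
  [seq mu <- [seq map val (mu : n.-bseq 'I_n.+1) | mu : n.-bseq 'I_n.+1] | is_partition n mu].

Notation rows mu := (nth 0%N mu).

Lemma partition_size n mu : is_partition n mu -> (size mu <= n)%N.
Proof.
case/and3P => _ mu0 /eqP <-; elim: mu mu0 => //= x mu IHmu.
by rewrite inE negb_or eq_sym -lt0n => /andP[x_gt0 /IHmu le_mu]; rewrite -add1n leq_add.
Qed.

Lemma rows_nil_ge n mu k : is_partition n mu -> (n <= k)%N -> rows mu k = 0%N.
Proof. by move=> /partition_size le_n le_k; rewrite nth_default // (leq_trans le_n). Qed.

Lemma rows_decr n mu k : is_partition n mu -> (rows mu k.+1 <= rows mu k)%N.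
Proof.
case/and3P => + _ _; elim: mu k => [|x mu IHmu] [|k] //=; last by move/path_sorted/IHmu.
by case: mu {IHmu} => //= y mu /andP[].
Qed.

Lemma sum_rows n mu N : is_partition n mu -> (n <= N)%N -> \sum_(k < N) rows mu k = n.
Proof.
move=> mu_n /(leq_trans (partition_size mu_n)); case/and3P: mu_n => _ _ /eqP <- {n}.
elim: mu N => [|x mu IHmu] [|N] //= le_N; first by rewrite big_ord0.
  by rewrite big1 // => k _; rewrite nth_nil.
by rewrite big_ord_recl /= IHmu.
Qed.

Lemma partition_rows_inj m n mu nu :
  is_partition m mu -> is_partition n nu -> rows mu =1 rows nu -> mu = nu.
Proof.
case/and3P => _ + _ /and3P[_ + _].
elim: mu nu => [|x mu IHmu] [|y nu] //=; rewrite ?inE ?negb_or.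
- by move=> _ /andP[/eqP y0 _] /(_ 0%N) /= /y0.
- by move=> /andP[/eqP x0 _] _ /(_ 0%N) /= /esym /x0.
move=> /andP[_ mu0] /andP[_ nu0] eq_r; congr (_ :: _); first exact: (eq_r 0%N).
by apply: IHmu => // k; apply: (eq_r k.+1).
Qed.

Lemma partition_of_rows N (r : nat -> nat) :
  (forall k, r k.+1 <= r k)%N -> r N = 0%N ->
  exists2 mu, is_partition (\sum_(k < N) r k) mu & rows mu =1 r.
Proof.
elim: N r => [|N IHN] r r_dec rN.
  exists [::]; first by rewrite big_ord0.
  by move=> k; rewrite nth_nil; elim: k => // k IHk; apply/esym/eqP; rewrite -leqn0 IHk r_dec.
have [mu mu_part mu_r] := IHN (fun k => r k.+1) (fun k => r_dec k.+1) rN.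
have [r0|r0] := posnP (r 0%N).
  exists [::]; first rewrite big1 // => k _.
    by elim: (k : nat) => // j IHj; apply/eqP; rewrite -leqn0 -IHj r_dec.
  by move=> k; rewrite nth_nil; elim: k => // k IHk; apply/esym/eqP; rewrite -leqn0 IHk r_dec.
exists (r 0%N :: mu); last by case.
case/and3P: mu_part => mu_sorted mu0 /eqP mu_sum.
rewrite /is_partition /= inE negb_or [0%N == _]eq_sym -lt0n r0 mu0.
rewrite big_ord_recl /= mu_sum eqxx !andbT.
case: mu mu_r mu_sorted {mu0 mu_sum} => //= x mu mu_r ->; rewrite andbT /=.
by rewrite -[x]/(rows (x :: mu) 0%N) mu_r r_dec.
Qed.

Lemma partitions_uniq n : uniq (partitions n).
Proof.
rewrite filter_uniq // map_inj_uniq ?enum_uniq //.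
by move=> mu nu eq_mn; apply/val_inj/(inj_map val_inj).
Qed.

Lemma mem_partitions n mu : (mu \in partitions n) = is_partition n mu.
Proof.
rewrite mem_filter; apply: andb_idr => mu_n.
have sz : (size [seq inord k : 'I_n.+1 | k <- mu] <= n)%N.
  by rewrite size_map partition_size.
have mu_val : mu = map val [seq inord k : 'I_n.+1 | k <- mu].
  rewrite -map_comp -[LHS]map_id; apply/eq_in_map => k mu_k /=.
  rewrite inordK // ltnS; case/and3P: mu_n => _ _ /eqP <-.
  by elim: mu mu_k {sz} => //= x mu IHmu; rewrite inE => /predU1P[->|/IHmu]; lia.
by apply/imageP; exists (Bseq sz).
Qed.

(** The form in which bijections are used below: summing a constant over a fibre
    with one element, a nonzero constant being what guarantees that the fibre is
    nonempty. *)
Lemma sum_unique (V : nmodType) (I : eqType) (s : seq I) (P : pred I) (c : V) :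
  uniq s -> (c != 0 -> exists2 x, x \in s & {in s, P =1 pred1 x}) ->
  \sum_(x <- s | P x) c = c.
Proof.
move=> s_uniq; have [-> _|_ /(_ isT)[x xs Px]] := eqVneq c 0; first by rewrite big1.
rewrite big_mkcond (bigD1_seq x) //= Px //= eqxx big1_seq ?addr0 // => y /andP[y_x ys].
by rewrite Px //= (negbTE y_x).
Qed.

(** * Growing partitions by one box *)

Section Recursion.
Variables (F : fieldType) (l1 l2 : F).
Hypothesis wt_inj : injective (wt l1 l2).
Variable n : nat.

Definition adds_box (i : 'I_n.+1) (mu nu : seq nat) :=
  [forall k : 'I_n.+1, rows nu k == ((k == i :> nat) + rows mu k)%N].

Lemma adds_boxP (i : 'I_n.+1) mu nu : mu \in partitions n -> nu \in partitions n.+1 ->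
  reflect (forall k : nat, rows nu k = ((k == i) + rows mu k)%N) (adds_box i mu nu).
Proof.
rewrite !mem_partitions => mu_n nu_n; apply: (iffP forallP) => [eq_r k|eq_r k].
  have [lt_k|le_k] := ltnP k n.+1; first exact/eqP/(eq_r (Ordinal lt_k)).
  rewrite (rows_nil_ge nu_n le_k) (rows_nil_ge mu_n (ltnW le_k)).
  by rewrite (gtn_eqF (leq_trans (ltn_ord i) le_k)).
by rewrite eq_r.
Qed.

Let H mu := hilb_weight l1 l2 n.+1 (rows mu).
Let down mu i := @down_weight F l1 l2 n.+1 (rows mu) i.
Let up mu i := @up_weight F l1 l2 n.+1 (rows mu) (widen_ord (leqnSn n.+1) i).

(** If row [i] of [nu] does not end in a removable box then both sides vanish. *)
Lemma sum_boxes_removed nu i : nu \in partitions n.+1 ->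
  \sum_(mu <- partitions n | adds_box i mu nu) H nu * down nu i = H nu * down nu i.
Proof.
move=> nu_n; have nuP := nu_n; rewrite mem_partitions in nuP.
apply: sum_unique (partitions_uniq n) _ => nz.
have lt_i : (rows nu i.+1 < rows nu i)%N.
  rewrite ltn_neqAle (rows_decr _ nuP) andbT; apply: contraNneq nz => eq_i.
  by rewrite /down down_weight_eq0 ?mulr0.
pose r (k : nat) := (rows nu k - (k == i))%N.
have r_dec k : (r k.+1 <= r k)%N.
  rewrite /r; have := rows_decr k nuP.
  by have [->|_] := eqVneq k i; [rewrite gtn_eqF //; lia | lia].
have nu_r k : rows nu k = ((k == i) + r k)%N.
  by rewrite /r; have [->|_] := eqVneq k i; lia.
have rN : r n.+1 = 0%N by rewrite /r (rows_nil_ge nuP).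
have [mu mu_part mu_r] := partition_of_rows r_dec rN.
have sum_r : \sum_(k < n.+1) r k = n.
  have := sum_rows nuP (leqnn _).
  rewrite (eq_bigr (fun k : 'I_n.+1 => ((k == i) + r k)%N)) => [|k _]; last exact: nu_r.
  by rewrite big_split /= (bigD1 i) //= eqxx big1 => [[]|k /negbTE->].
rewrite sum_r in mu_part.
exists mu; first by rewrite mem_partitions.
move=> mu' mu'_n; apply/(adds_boxP _ mu'_n nu_n)/eqP => [eq_r|-> k]; last by rewrite mu_r.
rewrite mem_partitions in mu'_n; apply: (partition_rows_inj mu'_n mu_part) => k.
by apply/eqP; rewrite mu_r -(eqn_add2l (k == i)) -nu_r eq_r.
Qed.

(** If no box can be added to row [i] of [mu] then both sides vanish. *)
Lemma sum_boxes_added mu i : mu \in partitions n ->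
  \sum_(nu <- partitions n.+1 | adds_box i mu nu) H mu * up mu i = H mu * up mu i.
Proof.
move=> mu_n; have muP := mu_n; rewrite mem_partitions in muP.
apply: sum_unique (partitions_uniq n.+1) _ => nz.
pose r (k : nat) := ((k == i) + rows mu k)%N.
have r_dec k : (r k.+1 <= r k)%N.
  rewrite /r; have := rows_decr k muP; have [ki|_] := eqVneq k.+1 i; last lia.
  have : rows mu k != rows mu k.+1.
    apply: contraNneq nz => eq_k; rewrite /up (@up_weight_eq0 _ _ _ _ _ _ k) ?mulr0 //.
    by rewrite /= -ki.
  lia.
have rN : r n.+1 = 0%N.
  by rewrite /r (rows_nil_ge muP) ?leqnSn // gtn_eqF.
have [nu nu_part nu_r] := partition_of_rows r_dec rN.
have sum_r : \sum_(k < n.+1) r k = n.+1.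
  rewrite big_split /= (sum_rows muP) ?leqnSn //.
  by rewrite (bigD1 i) //= eqxx big1 => [//|k /negbTE]; rewrite -val_eqE /= => ->.
rewrite sum_r in nu_part.
exists nu; first by rewrite mem_partitions.
move=> nu' nu'_n; apply/(adds_boxP _ mu_n nu'_n)/eqP => [eq_r|-> k]; last by rewrite nu_r.
rewrite mem_partitions in nu'_n; apply: (partition_rows_inj nu'_n nu_part) => k.
by rewrite nu_r eq_r.
Qed.

(** Double counting of the pairs of a partition of [n] and a partition of
    [n.+1] that differ by one box. *)
Lemma sum_hilb_weight_recursion :
  (\sum_(nu <- partitions n.+1) H nu) * (l1 * l2 *+ n.+1)
  = (\sum_(mu <- partitions n) H mu) * (l1 + l2).
Proof.
transitivity (\sum_(nu <- partitions n.+1) \sum_i H nu * down nu i).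
  rewrite mulr_suml big_seq [RHS]big_seq; apply: eq_bigr => nu.
  rewrite mem_partitions => nuP; rewrite -mulr_sumr sum_down_weight // ?(sum_rows nuP) //.
  exact: rows_nil_ge nuP _.
transitivity (\sum_(mu <- partitions n) \sum_i H mu * up mu i); last first.
  rewrite mulr_suml big_seq [RHS]big_seq; apply: eq_bigr => mu.
  rewrite mem_partitions => muP; rewrite -mulr_sumr; congr (_ * _).
  (* Row [n.+1] is empty and lies below an empty row, so it takes no box. *)
  have rn : rows mu n = 0%N by apply: rows_nil_ge muP _.
  have rN : rows mu n.+1 = 0%N by apply: rows_nil_ge muP (leqnSn n).
  rewrite -(sum_up_weight wt_inj rN) [RHS]big_ord_recr /=.
  by rewrite (@up_weight_eq0 _ _ _ _ _ _ n) ?addr0 //= rn rN.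
transitivity (\sum_(nu <- partitions n.+1) \sum_i \sum_(mu <- partitions n)
    if adds_box i mu nu then H nu * down nu i else 0).
  rewrite big_seq [RHS]big_seq; apply: eq_bigr => nu nu_n; apply: eq_bigr => i _.
  by rewrite -big_mkcond sum_boxes_removed.
transitivity (\sum_(mu <- partitions n) \sum_i \sum_(nu <- partitions n.+1)
    if adds_box i mu nu then H mu * up mu i else 0); last first.
  rewrite big_seq [RHS]big_seq; apply: eq_bigr => mu mu_n; apply: eq_bigr => i _.
  by rewrite -big_mkcond sum_boxes_added.
under eq_bigr do rewrite exchange_big /=.
rewrite exchange_big /= big_seq [RHS]big_seq; apply: eq_bigr => mu mu_n.
rewrite exchange_big /=; apply: eq_bigr => i _.
rewrite big_seq [RHS]big_seq; apply: eq_bigr => nu nu_n.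
case: (adds_boxP i mu_n nu_n) => // nuE.
rewrite mem_partitions in mu_n; rewrite mem_partitions in nu_n.
apply: hilb_weight_balance => //.
- exact: rows_nil_ge mu_n (leqnSn n).
- by move=> k; apply: rows_decr mu_n.
- by move=> k; apply: rows_decr nu_n.
Qed.
End Recursion.

(** * Virtual characters *)

(** Operations on virtual characters are defined by iteration over the support,
    which is not additive in its argument; they are additive because each
    term is additive in the coefficient and trivial at 0. *)
Lemma big_domD (T : eqType) (idx : T) (op : Monoid.com_law idx)
    (f : int * int -> int -> T) (V W : vchar) :
  (forall x, f x 0 = idx) -> (forall x, {morph f x : a b / a + b >-> op a b}) ->
  \big[op/idx]_(x <- dom (V + W)) f x (coeff x (V + W)) =
  op (\big[op/idx]_(x <- dom V) f x (coeff x V))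
     (\big[op/idx]_(x <- dom W) f x (coeff x W)).
Proof.
move=> f0 fD; pose s := undup (dom (V + W) ++ dom V ++ dom W).
have widen U : {subset dom U <= s} ->
    \big[op/idx]_(x <- dom U) f x (coeff x U) = \big[op/idx]_(x <- s) f x (coeff x U).
  move=> sub_s; apply: perm_big_supp; apply: uniq_perm.
  - by rewrite filter_uniq ?uniq_dom.
  - by rewrite filter_uniq ?undup_uniq.
  move=> x; rewrite !mem_filter; case: eqVneq => //= nz.
  suff xU : x \in dom U by rewrite xU (sub_s _ xU).
  by rewrite mem_dom; apply: contraNneq nz => ->; rewrite f0.
have in_s x : (x \in s) = [|| x \in dom (V + W), x \in dom V | x \in dom W].
  by rewrite mem_undup !mem_cat.
rewrite !widen => [|x x_W|x x_V|x x_VW]; rewrite ?in_s ?x_W ?x_V ?x_VW ?orbT //.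
by rewrite -big_split; apply: eq_bigr => x _; rewrite coeffD fD.
Qed.

Lemma vmulDl (W V V' : vchar) : vmul (V + V') W = vmul V W + vmul V' W.
Proof.
apply: (big_domD (op := +%R)
  (f := fun x a => \sum_(y <- dom W) << a * coeff y W *g x + y >>)) => [x|x a b].
  by apply: big1 => y _; rewrite mul0r freegU0.
by rewrite -big_split; apply: eq_bigr => y _; rewrite mulrDl -freegUD.
Qed.

Lemma vmulDr (V W W' : vchar) : vmul V (W + W') = vmul V W + vmul V W'.
Proof.
rewrite /vmul -big_split; apply: eq_bigr => x _.
apply: (big_domD (op := +%R)
  (f := fun y b => << coeff x V * b *g x + y >>)) => [y|y a b].
  by rewrite mulr0 freegU0.
by rewrite mulrDr -freegUD.
Qed.

Lemma vdualD : {morph vdual : V W / V + W}.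
Proof.
move=> V W.
apply: (big_domD (op := +%R) (f := fun x a => << a *g - x >>)) => [x|x a b].
  by rewrite freegU0.
by rewrite -freegUD.
Qed.

Lemma vmul0l W : vmul 0 W = 0. Proof. by rewrite /vmul dom0 big_nil. Qed.
Lemma vmul0r V : vmul V 0 = 0.
Proof. by rewrite /vmul big1 // => x _; rewrite dom0 big_nil. Qed.
Lemma vdual0 : vdual 0 = 0. Proof. by rewrite /vdual dom0 big_nil. Qed.

HB.instance Definition _ V := GRing.isNmodMorphism.Build vchar vchar (vmul V)
  (conj (vmul0r V) (vmulDr V)).
(** A head constant for right multiplication, on which the additive structure
    can be declared. *)
Definition vmulr W V := vmul V W.
HB.instance Definition _ W := GRing.isNmodMorphism.Build vchar vchar (vmulr W)
  (conj (vmul0l W) (vmulDl W)).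
HB.instance Definition _ := GRing.isNmodMorphism.Build vchar vchar vdual
  (conj vdual0 vdualD).

Lemma vmul_mon a b c d : vmul (vmon a b) (vmon c d) = vmon (a + c) (b + d).
Proof. by rewrite /vmul !domU1 !big_seq1 !coeffU !eqxx. Qed.

Lemma vdual_mon a b : vdual (vmon a b) = vmon (- a) (- b).
Proof. by rewrite /vdual !domU1 !big_seq1 !coeffU !eqxx. Qed.

Lemma vmulBl (W V V' : vchar) : vmul (V - V') W = vmul V W - vmul V' W.
Proof. exact: (raddfB (vmulr W)). Qed.
Lemma vmulBr (W V V' : vchar) : vmul W (V - V') = vmul W V - vmul W V'.
Proof. exact: raddfB. Qed.
Lemma vmul_suml (W : vchar) I (s : seq I) (P : pred I) f :
  vmul (\sum_(i <- s | P i) f i) W = \sum_(i <- s | P i) vmul (f i) W.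
Proof. exact: (raddf_sum (vmulr W)). Qed.

Lemma vmul_sumr (W : vchar) I (s : seq I) (P : pred I) f :
  vmul W (\sum_(i <- s | P i) f i) = \sum_(i <- s | P i) vmul W (f i).
Proof. exact: raddf_sum. Qed.
Lemma vdual_sum I (s : seq I) (P : pred I) (f : I -> vchar) :
  vdual (\sum_(i <- s | P i) f i) = \sum_(i <- s | P i) vdual (f i).
Proof. exact: raddf_sum. Qed.

Lemma Qchar_rows n N mu : is_partition n mu -> (n <= N)%N ->
  Qchar mu = \sum_(a < N) \sum_(j < rows mu a) vmon (- j%:Z) (- a%:Z).
Proof.
move=> mu_n le_nN; rewrite /Qchar.
rewrite (big_ord_widen N (fun a => \sum_(j < rows mu a) vmon (- j%:Z) (- a%:Z))
  (leq_trans (partition_size mu_n) le_nN)).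
rewrite big_mkcond; apply: eq_bigr => a _; case: ltnP => // le_a.
by rewrite nth_default // big_ord0.
Qed.


Lemma vmul_vdual_Qchar n N mu : is_partition n mu -> (n <= N)%N ->
  vmul (vmul (vmon 0 0 - t1) (vmon 0 0 - t2)) (vdual (Qchar mu)) =
  vmon 0 0 + (\sum_(k < N) vmon (rows mu k)%:Z k.+1%:Z
              - \sum_(k < N.+1) vmon (rows mu k)%:Z k%:Z).
Proof.
move=> mu_n le_nN.
rewrite (sum_corners (fun a j => vmon j%:Z a%:Z)) ?(rows_nil_ge mu_n) //.
rewrite [RHS]addrC subrK (Qchar_rows mu_n le_nN) vdual_sum vmul_sumr; apply: eq_bigr => a _.
rewrite vdual_sum vmul_sumr; apply: eq_bigr => j _ /=; rewrite vdual_mon !opprK.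
rewrite !vmulBl !vmulBr !vmul_mon !vmulBl !vmul_mon !add0r !addr0 !intS.
by rewrite opprB addrACA opprD [in RHS](addrC (- _)).
Qed.

(** The terms [Q] and [1 * Q] cancel, which leaves only products of a box with
    the inverse of a boundary point. *)
Lemma Tvir_rows n N mu : is_partition n mu -> (n <= N)%N ->
  Tvir mu =
    \sum_(a < N) \sum_(j < rows mu a)
       (\sum_(k < N.+1) vmon ((rows mu k)%:Z - j%:Z) (k%:Z - a%:Z)
        - \sum_(k < N) vmon ((rows mu k)%:Z - j%:Z) (k.+1%:Z - a%:Z)).
Proof.
move=> mu_n le_nN; rewrite /Tvir /=.
rewrite (vmul_vdual_Qchar mu_n le_nN) (Qchar_rows mu_n le_nN).
rewrite !vmul_sumr -sumrB; apply: eq_bigr => a _.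
rewrite !vmul_sumr -sumrB; apply: eq_bigr => j _.
rewrite vmulDl vmulBl !vmul_suml vmul_mon !add0r opprD addrA subrr sub0r opprB.
by congr (_ - _); apply: eq_bigr => k _; rewrite vmul_mon.
Qed.

(** * Euler classes *)

Section Euler.
Variable R : realType.

Lemma c1_eq0 (chi : int * int) : c1 R chi = 0 -> chi = 0.
Proof.
case: chi => a b; rewrite /c1 /lam1 /lam2 /=.
rewrite -!raddfMz -raddfD /= => /eqP; rewrite tofrac_eq0 => /eqP eq0.
have coef0 (k : 'I_2) : (0 == k)%:R *~ a + (1 == k)%:R *~ b = 0 :> R[i].
  have := congr1 (mcoeff U_(k)) eq0.
  by rewrite mcoeffD !raddfMz /= !mcoeffXU mcoeff0.
have := coef0 0; have := coef0 1.
rewrite /= !mul0rz addr0 add0r => /eqP; rewrite intr_eq0 => /eqP->.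
by move=> /eqP; rewrite intr_eq0 => /eqP->.
Qed.

(** A nonzero value at the trivial character makes the Euler class
    multiplicative on all virtual characters. *)
Definition c1_reg (chi : int * int) : ratfun R := if chi == 0 then 1 else c1 R chi.

Lemma c1_reg_neq0 chi : c1_reg chi != 0.
Proof.
rewrite /c1_reg; case: ifPn => [_|nz]; first by rewrite oner_eq0.
by apply: contraNneq nz => /c1_eq0 ->.
Qed.

Definition euler_reg (V : vchar) : ratfun R := \prod_(chi <- dom V) c1_reg chi ^ coeff chi V.

Lemma euler_regD V W : euler_reg (V + W) = euler_reg V * euler_reg W.
Proof.
apply: (big_domD (op := @GRing.mul (ratfun R) : Monoid.com_law 1)
  (f := fun x a => c1_reg x ^ a)) => [x|x a b]; first exact: expr0z.
by rewrite /= expfzDr ?c1_reg_neq0.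
Qed.

Lemma euler_reg_mon a b : euler_reg (vmon a b) = c1_reg (a, b).
Proof. by rewrite /euler_reg domU1 big_seq1 coeffU eqxx mulr1 expr1z. Qed.

Lemma euler_reg0 : euler_reg 0 = 1. Proof. by rewrite /euler_reg dom0 big_nil. Qed.

Lemma euler_reg_sum I (s : seq I) (P : pred I) (f : I -> vchar) :
  euler_reg (\sum_(i <- s | P i) f i) = \prod_(i <- s | P i) euler_reg (f i).
Proof. exact: (big_morph euler_reg euler_regD euler_reg0). Qed.

Lemma euler_regB V W : euler_reg (V - W) = euler_reg V / euler_reg W.
Proof.
have nzW : euler_reg W != 0.
  by rewrite prodf_seq_neq0; apply/allP => x _; rewrite expfz_neq0 ?c1_reg_neq0.
by apply: (mulIf nzW); rewrite divfK // -euler_regD subrK.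
Qed.

Lemma euler_euler_reg V : coeff 0 V = 0 -> euler R V = euler_reg V.
Proof.
move=> V0; rewrite /euler /euler_reg !big_seq; apply: eq_bigr => chi.
by rewrite mem_dom /c1_reg; case: (chi =P 0) => [->|//]; rewrite V0 eqxx.
Qed.

Lemma wt_ratfun_inj : injective (wt (lam1 R) (lam2 R)).
Proof.
move=> [a j] [a' j'] eq_wt.
have /c1_eq0[] : c1 R (j'%:Z - j%:Z, a'%:Z - a%:Z) = 0.
  rewrite /c1 /= !mulrzBr -!pmulrn; apply/eqP; move/eqP: eq_wt.
  rewrite /wt /= -subr_eq0 => /eqP eq0; apply/eqP; rewrite -[RHS]eq0; ring.
by move=> /eqP; rewrite subr_eq0 => /eqP[->] /eqP; rewrite subr_eq0 => /eqP[->].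
Qed.

Lemma wdiff_c1 a j b k :
  wdiff (lam1 R) (lam2 R) (a, j) (b, k) = c1_reg (k%:Z - j%:Z, b%:Z - a%:Z).
Proof.
rewrite /wdiff /c1_reg !xpair_eqE !subr_eq0 !eqz_nat.
rewrite andbC (eq_sym a) (eq_sym j); case: ifP => // _.
rewrite /wt /c1 /= !mulrzBr -!pmulrn; ring.
Qed.

(** A box [(a, j)] lies inside its row, so it is not [x_a]; and it is not
    [y_(a-1)], as the row above is at least as long. *)
Lemma coeff0_Tvir n mu : is_partition n mu -> coeff 0 (Tvir mu) = 0.
Proof.
move=> mu_n; rewrite (Tvir_rows mu_n (leqnn n)).
rewrite raddf_sum big1 // => a _; rewrite raddf_sum big1 // => j _.
have not0 (u v b c : nat) : (u, b) <> (v, c) -> coeff 0 (vmon (u%:Z - v%:Z) (b%:Z - c%:Z)) = 0.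
  move=> neq; rewrite coeffU mul1r; case: eqP => // -[/eqP + /eqP].
  by rewrite !subr_eq0 !eqz_nat => /eqP uv /eqP bc; case: neq; rewrite uv bc.
have lt_j := ltn_ord j.
rewrite -[LHS]/(coeff 0 (_ - _)) coeffB !raddf_sum !big1 ?subr0 // => k _ /=;
  rewrite not0 ?oppr0 // => -[rk ka].
  by have := rows_decr k mu_n; rewrite ka rk leqNgt lt_j.
by rewrite -rk -ka ltnn in lt_j.
Qed.

Lemma euler_Tvir n N mu : is_partition n mu -> (n <= N)%N ->
  (euler R (Tvir mu))^-1 = hilb_weight (lam1 R) (lam2 R) N (rows mu).
Proof.
move=> mu_n le_nN; rewrite euler_euler_reg ?(coeff0_Tvir mu_n) // (Tvir_rows mu_n le_nN).
rewrite euler_reg_sum -prodfV; apply: eq_bigr => a _.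
rewrite euler_reg_sum -prodfV; apply: eq_bigr => j _.
rewrite euler_regB invf_div !euler_reg_sum /box_weight.
by congr (_ / _); apply: eq_bigr => k _; rewrite euler_reg_mon wdiff_c1.
Qed.

End Euler.


Lemma hilb_vir_integral_partitions (R : realType) n :
  hilb_vir_integral R n = \sum_(mu <- partitions n) (euler R (Tvir mu))^-1.
Proof.
by rewrite /partitions big_filter [RHS]big_map big_enum_cond.
Qed.

(** * The generating series *)

Lemma exp_recursion (F : fieldType) (a : nat -> F) (u v : F) :
  u != 0 -> (forall n, n.+1%:R != 0 :> F) -> a 0%N = 1 ->
  (forall n, a n.+1 * (u *+ n.+1) = a n * v) ->
  forall n, a n = (v / u) ^+ n / n`!%:R.
Proof.
move=> nz_u nz_n a0 aS; elim=> [|n IHn]; first by rewrite a0 expr0 fact0 divr1.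
have nz_fact : n`!%:R != 0 :> F by rewrite -(prednK (fact_gt0 n)) nz_n.
have nz : u *+ n.+1 != 0 by rewrite -mulr_natr mulf_neq0.
apply: (mulIf nz); rewrite aS IHn factS natrM exprSr -mulr_natr.
by field; rewrite nz_fact nz_u andbT -mulrS nz_n.
Qed.

Theorem corollary1p5 (R : realType) :
  hilb_vir_integral R
    =1 fps_exp (((lam1 R + lam2 R) / (lam1 R * lam2 R)) *: 'X).
Proof.
move=> n; pose c := (lam1 R + lam2 R) / (lam1 R * lam2 R).
have -> : fps_exp (c *: 'X) n = c ^+ n / n`!%:R.
  rewrite /fps_exp coef_sum big_ord_recr big1 => [|k _] /=.
    by rewrite add0r coefZ exprZn coefZ coefXn eqxx mulr1 mulrC.
  by rewrite coefZ exprZn coefZ coefXn gtn_eqF ?mulr0.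
have wt_inj := wt_ratfun_inj (R := R).
apply: (exp_recursion (a := hilb_vir_integral R)) => [||| {}n].
- exact: mulf_neq0 (l1_neq0 wt_inj) (l2_neq0 wt_inj).
- exact: natr_neq0 wt_inj.
- rewrite hilb_vir_integral_partitions.
  have -> : partitions 0 = [:: [::]].
    apply/perm_small_eq/uniq_perm => //; first exact: partitions_uniq.
    move=> mu; rewrite mem_partitions mem_seq1; apply/idP/eqP => [/partition_size|-> //].
    by rewrite leqn0 size_eq0 => /eqP.
  by rewrite big_seq1 (@euler_Tvir R 0 0) // /hilb_weight big_ord0.
have eqH m : (m <= n.+1)%N -> hilb_vir_integral R m
    = \sum_(mu <- partitions m) hilb_weight (lam1 R) (lam2 R) n.+1 (rows mu).
  move=> le_m; rewrite hilb_vir_integral_partitions big_seq [RHS]big_seq.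
  by apply: eq_bigr => mu; rewrite mem_partitions => mu_m; apply: euler_Tvir mu_m le_m.
by rewrite !eqH //; apply: sum_hilb_weight_recursion wt_inj n.
Qed.
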